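(* Let $0<\alpha<1$ and let $T$ be a $(C,\alpha)$-bounded linear operator on a complex Banach space $X$. Then $T$ is uniformly ergodic if and only if $D(H)=(I-T)X$.
   Context: For $\beta>-1$ put $A_0^\beta=1$ and $A_n^\beta=(\beta+n)(\beta+n-1)\cdots(\beta+1)/n!$ for $n\ge1$. For a bounded linear operator $T$ the Cesàro means of order $\alpha$ are $M_n^\alpha=S_n^\alpha/A_n^\alpha$, where $S_n^\alpha=\sum_{k=0}^n A_{n-k}^{\alpha-1}T^k$. $T$ is $(C,\alpha)$-bounded if $\sup_n\|M_n^\alpha\|<\infty$. $T$ is uniformly ergodic if $\frac1n\sum_{k=1}^nT^k$ converges in operator norm. $D(H)$ denotes the set of $x\in X$ for which $\lim_{n\to\infty}\sum_{k=1}^n\frac1kT^kx$ exists in norm. *)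

(* Defs.v *)
From HB Require Import structures.
From mathcomp Require Import all_boot all_order all_algebra.
From mathcomp Require Import complex.
From mathcomp Require Import boolp classical_sets functions reals ereal topology normedtype sequences.

Set Implicit Arguments.
Unset Strict Implicit.
Unset Printing Implicit Defensive.

Import Order.TTheory GRing.Theory Num.Theory.
Import numFieldNormedType.Exports.

Local Open Scope classical_set_scope.
Local Open Scope ring_scope.
Local Open Scope complex_scope.

(* [A_n^b = (b + n) ... (b + 1) / n!]; the empty product gives [A_0^b = 1]. *)
Definition cesaro_num (R : realType) (b : R) (n : nat) : R :=
  (\prod_(j < n) (b + j.+1%:R)) / n`!%:R.

(* The norm of a normed module over [R[i]] takes its values in [R[i]], where
   they are nonnegative reals; [complex.Re] brings them back to [R]. The value
   is [+oo] exactly when [f] is unbounded on the unit ball. *)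
Definition opnorm (R : realType) (X : normedModType R[i]) (f : X -> X) : \bar R :=
  ereal_sup [set (complex.Re `|f x|)%:E | x in [set x : X | `|x| <= 1]].

Section OperatorMeans.
Variables (R : realType) (X : normedModType R[i]) (T : X -> X).

Definition cesaro_sum (a : R) (n : nat) : X -> X :=
  fun x => \sum_(0 <= k < n.+1) (cesaro_num (a - 1) (n - k))%:C *: iter k T x.

Definition cesaro_mean (a : R) (n : nat) : X -> X :=
  fun x => ((cesaro_num a n)^-1)%:C *: cesaro_sum a n x.

Definition cesaro_bounded (a : R) : Prop :=
  (ereal_sup (range (fun n => opnorm (cesaro_mean a n))) < +oo)%E.

(* At [n = 0], which is irrelevant to the limit, this is [0]. *)
Definition ergodic_mean (n : nat) : X -> X :=
  fun x => n%:R^-1 *: \sum_(1 <= k < n.+1) iter k T x.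

Definition uniformly_ergodic : Prop :=
  exists P : {linear X -> X}, continuous P /\
    opnorm (fun x => ergodic_mean n x - P x) @[n --> \oo] --> 0%E.

Definition hilbert_domain : set X :=
  [set x | cvgn (fun n : nat => \sum_(1 <= k < n.+1) k%:R^-1 *: iter k T x)].

End OperatorMeans.

(* Main.v *)
From HB Require Import structures.
Require Import Defs.
From mathcomp Require Import all_boot all_order all_algebra.
From mathcomp Require Import complex.
From mathcomp Require Import boolp classical_sets functions reals ereal topology normedtype sequences.
From mathcomp Require Import ring lra zify.

(** Write [A = I - T], [c_n] for the Cesàro number [A_n^a], and [M_n] for the
    [n]-th ergodic mean.

    Inverting the Cesàro transform, [T^n] is the sum of [A_(n-k)^(-a-1) S_k^a]
    over [k <= n], so [(C,a)]-boundedness gives [||T^n|| = O(c_n)], which is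
    [o(n)] because [a < 1] ([cesaro_growth], [cvg_cesaro_num_div]). Everything
    else rests on this growth bound.

    The coefficients of [(1 - z)^g] are the Cesàro numbers of order [- g - 1],
    of size [k^(-g-1)].  Hence for [a < g <= 1] the binomial series in [T]
    converges absolutely and defines the fractional power [A^g]
    ([cvg_frac_pow]).  Its range lies in [D(H)] ([frac_pow_hilbert]): for a small
    [d > 0] the partial sums of [A^(-d)] composed with [A^g] are bounded, and
    the weights [1 / k] are obtained from the coefficients of [(1 - z)^(-d)] by
    multiplying with a sequence decreasing to [0], so that Dirichlet's test
    applies.  With [g = 1] this says that [A X] is contained in [D(H)].

    Suppose [D(H) = A X].  Take [g = p / (p + 1) > a].  Then [A^g X] is contained
    in [A X], hence [A^p X = (A^g)^(p+1) X] is contained in [A^(p+1) X].  As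
    [||T^n|| = o(n)], the kernels of [A^2] and [A] coincide, and therefore
    [X = A X + ker A] ([hilbert_decomposition]).  On [x = A y + f] with
    [A f = 0], telescoping gives [M_n x - f = (T y - T^(n+1) y) / n], which is
    [O(c_n / n)] for each [x]; the uniform boundedness principle turns this
    pointwise rate into a rate in operator norm
    ([decomposition_uniformly_ergodic]).

    Conversely, let [M_n] converge to [P] in norm.  Then [P] is the projection
    on [ker A] that vanishes on [A X], and a single mean [Q = M_n] with
    [||Q - P|| <= 1/2] contracts [ker P].  Since [I - Q] factors through [A],
    iterating [x = (x - Q x) + Q x] writes every [x] in [ker P] as an element of
    [A X].  A vector of [D(H)] differs from its projection [P x] by an element
    of [A X], so the harmonic series times [P x] converges, which forces
    [P x = 0] ([uniformly_ergodic_hilbert_domain]). *)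

Set Implicit Arguments.
Unset Strict Implicit.
Unset Printing Implicit Defensive.

Import Order.TTheory GRing.Theory Num.Theory.
Import numFieldNormedType.Exports.

Local Open Scope classical_set_scope.
Local Open Scope ring_scope.
Local Open Scope complex_scope.

(** * Cesàro numbers *)

Section CesaroNumbers.
Variable R : realType.
Implicit Types (b s t a g : R) (n k : nat).

Lemma cesaro_num0 b : cesaro_num b 0 = 1.
Proof. by rewrite /cesaro_num big_ord0 fact0 divr1. Qed.

Lemma cesaro_numS b n :
  cesaro_num b n.+1 = cesaro_num b n * ((b + n.+1%:R) / n.+1%:R).
Proof.
rewrite /cesaro_num big_ord_recr factS natrM /=; field.
rewrite nat1r !pnatr_eq0 -?lt0n; exact: fact_gt0.
Qed.

Lemma cesaro_num_rec b n :
  n.+1%:R * cesaro_num b n.+1 = (b + n.+1%:R) * cesaro_num b n.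
Proof. by rewrite cesaro_numS; field; rewrite nat1r pnatr_eq0. Qed.

Lemma cesaro_numN1 n : cesaro_num (-1 : R) n = (n == 0)%:R.
Proof.
elim: n => [|n IH]; first by rewrite cesaro_num0.
rewrite cesaro_numS IH; case: n {IH} => [|n]; last by rewrite mul0r.
by rewrite addNr mul0r mulr0.
Qed.

(** Both sides expand to [b (b + 1) ... (b + n) / n!]. *)
Lemma cesaro_num_shift b n :
  n.+1%:R * cesaro_num (b - 1) n.+1 = b * cesaro_num b n.
Proof.
elim: n => [|n IH].
  by rewrite cesaro_num_rec !cesaro_num0 subrK.
have n0 : n.+1%:R != 0 :> R by rewrite pnatr_eq0.
apply: (mulfI n0); rewrite cesaro_num_rec mulrCA IH [RHS]mulrCA cesaro_num_rec.
by rewrite -[n.+2%:R]natr1; ring.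
Qed.

Lemma cesaro_num_pascal b n :
  cesaro_num b n.+1 = cesaro_num b n + cesaro_num (b - 1) n.+1.
Proof.
have n0 : n.+1%:R != 0 :> R by rewrite pnatr_eq0.
apply: (mulfI n0); rewrite cesaro_num_rec mulrDr cesaro_num_shift; ring.
Qed.

(** The Chu-Vandermonde identity [(1 - z)^(-s-1) (1 - z)^(-t-1) =
    (1 - z)^(-s-t-2)].  Both sides satisfy the first-order recurrence in [n]
    that comes from [(1 - z) f' = (s + 1) f]. *)
Lemma cesaro_num_convol s t n :
  \sum_(k < n.+1) cesaro_num s k * cesaro_num t (n - k) = cesaro_num (s + t + 1) n.
Proof.
elim: n => [|n IH]; first by rewrite big_ord1 !cesaro_num0 mul1r.
have n0 : n.+1%:R != 0 :> R by rewrite pnatr_eq0.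
apply: (mulfI n0); rewrite cesaro_num_rec -IH !mulr_sumr.
pose F k := k%:R * cesaro_num s k * cesaro_num t (n.+1 - k).
pose G k := cesaro_num s k * ((n.+1 - k)%:R * cesaro_num t (n.+1 - k)).
rewrite (eq_bigr (fun k : 'I_n.+2 => F k + G k)); last first.
  move=> k _; have kn : (k <= n.+1)%N by rewrite -ltnS.
  rewrite /F /G natrB //; ring.
rewrite big_split /= big_ord_recl /F mul0r mul0r add0r.
rewrite [X in _ + X]big_ord_recr /G /= subnn mul0r mulr0 addr0 -big_split /=.
apply: eq_bigr => k _; have kn : (k <= n)%N by rewrite -ltnS.
rewrite /bump /= add1n subSS subSn // !cesaro_num_rec.
rewrite -[n.+1%:R]natr1 -[(n - k).+1%:R]natr1 -[k.+1%:R]natr1 natrB //; ring.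
Qed.

Lemma cesaro_num_gt0 b n : -1 < b -> 0 < cesaro_num b n.
Proof.
move=> b1; elim: n => [|n IH]; first by rewrite cesaro_num0.
rewrite cesaro_numS mulr_gt0 // divr_gt0 ?ltr0n //.
by rewrite -natr1; have := ler0n R n; lra.
Qed.

Lemma cesaro_num_ge0 b n : -1 <= b -> 0 <= cesaro_num b n.
Proof.
rewrite le_eqVlt => /predU1P[<-|/cesaro_num_gt0/ltW //].
by rewrite cesaro_numN1 ler0n.
Qed.

Lemma cesaro_num_nd b : 0 <= b ->
  {homo cesaro_num b : n k / (n <= k)%N >-> n <= k}.
Proof.
move=> b0; apply: homo_leq => // [x y z|n]; first exact: le_trans.
rewrite cesaro_num_pascal lerDl cesaro_num_ge0 //; lra.
Qed.

Lemma cesaro_num_ni b : -1 <= b -> b <= 0 ->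
  {homo cesaro_num b : n k / (n <= k)%N >-> k <= n}.
Proof.
move=> b1 b0; apply: (homo_leq (r := fun x y => y <= x)) => // [x y z|n].
  by move=> xy yz; exact: le_trans yz xy.
rewrite cesaro_numS ler_piMr ?cesaro_num_ge0 // ler_pdivrMr ?ltr0n //; lra.
Qed.

(** For [0 <= b <= 1] the increments, which are Cesàro numbers of order
    [b - 1 <= 0], decrease: the sequence is concave. *)
Lemma cesaro_num_subadd b n k : 0 <= b -> b <= 1 ->
  cesaro_num b (n + k) <= cesaro_num b n + cesaro_num b k.
Proof.
move=> b0 b1; suff: cesaro_num b (n + k) + 1 <= cesaro_num b n + cesaro_num b k.
  lra.
elim: k => [|k IH]; first by rewrite addn0 cesaro_num0.
rewrite addnS (cesaro_num_pascal b (n + k)) (cesaro_num_pascal b k).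
have : cesaro_num (b - 1) (n + k).+1 <= cesaro_num (b - 1) k.+1.
  by apply: cesaro_num_ni; [lra | lra | rewrite ltnS leq_addl].
lra.
Qed.

(** The increment at [k + 1] is [b / (k + 1)] times the Cesàro number at [k],
    which is at least [1]. *)
Lemma cesaro_num_ge_harmonic b n : 0 <= b ->
  1 + b * \sum_(k < n) k.+1%:R^-1 <= cesaro_num b n.
Proof.
move=> b0; elim: n => [|n IH]; first by rewrite big_ord0 cesaro_num0 mulr0 addr0.
rewrite big_ord_recr /= mulrDr addrA cesaro_num_pascal lerD //.
have -> : cesaro_num (b - 1) n.+1 = b * n.+1%:R^-1 * cesaro_num b n.
  by rewrite mulrAC -cesaro_num_shift mulrAC mulfV ?pnatr_eq0 // mul1r.
have : cesaro_num b 0 <= cesaro_num b n by apply: cesaro_num_nd.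
by rewrite cesaro_num0 => ?; rewrite ler_peMr // mulr_ge0.
Qed.

Lemma cesaro_num_cvgy b : 0 < b -> cesaro_num b n @[n --> \oo] --> +oo.
Proof.
move=> b0; apply/cvgryPge => A.
have H : series (@harmonic R) n @[n --> \oo] --> +oo.
  apply: (@nondecreasing_dvgn_lt R (series harmonic)); last exact: dvg_harmonic.
  by apply/nondecreasing_series => i _; rewrite /= invr_ge0.
near=> n; apply: le_trans (cesaro_num_ge_harmonic n (ltW b0)).
have : A / b <= series harmonic n by near: n; move/cvgryPge: H; apply.
rewrite /series /= big_mkord ler_pdivrMr // [X in _ <= X]mulrC.
by move/le_trans; apply; rewrite lerDr.
Unshelve. all: by end_near. Qed.

Lemma cesaro_num_opp1 g n :
  cesaro_num (- g - 1) n.+1 = - (g / n.+1%:R * cesaro_num (- g) n).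
Proof.
have n0 : n.+1%:R != 0 :> R by rewrite pnatr_eq0.
by apply: (mulfI n0); rewrite cesaro_num_shift; field; rewrite nat1r.
Qed.

(** For [0 <= g <= 1] all coefficients of [(1 - z)^g] but the first are
    nonpositive, so that their absolute values telescope. *)
Lemma norm_cesaro_num_opp1 g n : 0 <= g -> g <= 1 ->
  `|cesaro_num (- g - 1) n.+1| = cesaro_num (- g) n - cesaro_num (- g) n.+1.
Proof.
move=> g0 g1; rewrite [cesaro_num (- g) n.+1]cesaro_num_pascal opprD addNKr ler0_norm //.
by rewrite cesaro_num_opp1 oppr_le0 mulr_ge0 ?cesaro_num_ge0 ?divr_ge0 //; lra.
Qed.

Lemma sum_norm_cesaro_num_opp1 g m n : 0 <= g -> g <= 1 -> (m <= n)%N ->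
  \sum_(m <= j < n) `|cesaro_num (- g - 1) j.+1| =
  cesaro_num (- g) m - cesaro_num (- g) n.
Proof.
move=> g0 g1 mn; under eq_bigr do rewrite norm_cesaro_num_opp1 // -opprB.
by rewrite sumrN telescope_sumr // opprB.
Qed.

Lemma cesaro_num_double a n : 0 <= a -> a <= 1 ->
  cesaro_num a n.+1 <= 2 * cesaro_num a n.
Proof.
move=> a0 a1; rewrite cesaro_numS mulrC ler_wpM2r ?cesaro_num_ge0 //; first lra.
rewrite ler_pdivrMr ?ltr0n // -natr1; have := ler0n R n; lra.
Qed.

(** The product [A_n^(-g) A_n^a], of size [n^(a-g)], decreases at the relative
    rate [(g - a) / n]; this makes the weighted sums below telescope. *)
Lemma cesaro_num_prod_decr a g n : 0 <= a -> a <= g -> g <= 1 ->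
  (g - a) / n.+1%:R * (cesaro_num (- g) n * cesaro_num a n) <=
  cesaro_num (- g) n * cesaro_num a n - cesaro_num (- g) n.+1 * cesaro_num a n.+1.
Proof.
move=> a0 ag g1; rewrite !cesaro_numS.
have : 0 <= cesaro_num (- g) n by rewrite cesaro_num_ge0 //; lra.
have : 0 <= cesaro_num a n by rewrite cesaro_num_ge0 //; lra.
move: (cesaro_num (- g) n) (cesaro_num a n) => c w w0 c0.
have n0 : (0 : R) < n.+1%:R by rewrite ltr0n.
rewrite -subr_ge0; set k := n.+1%:R in n0 *.
rewrite [X in 0 <= X](_ : _ = c * w * (g * a / (k * k))); last first.
  by field; rewrite gt_eqF.
have g0 : 0 <= g by lra.
by rewrite mulr_ge0 ?mulr_ge0 ?invr_ge0 ?mulr_ge0 // ltW.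
Qed.

Lemma cesaro_num_prod_le1 a g n : 0 <= a -> a <= g -> g <= 1 ->
  cesaro_num (- g) n * cesaro_num a n <= 1.
Proof.
move=> a0 ag g1; elim: n => [|n IH]; first by rewrite !cesaro_num0 mul1r.
apply: le_trans IH; rewrite -subr_ge0.
apply: le_trans (cesaro_num_prod_decr n a0 ag g1).
have c0 : 0 <= cesaro_num (- g) n by rewrite cesaro_num_ge0 //; lra.
have w0 : 0 <= cesaro_num a n by rewrite cesaro_num_ge0 //; lra.
by apply: mulr_ge0 (mulr_ge0 c0 w0); rewrite divr_ge0 // subr_ge0.
Qed.

(** Tails of the coefficients of [(1 - z)^g] against the weight [A_j^a]: the
    general term is [O(1 / j)] times the decreasing product of the previous
    lemma, hence bounded by its decrement. *)
Lemma sum_norm_cesaro_num_weight a g m n :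
  0 <= a -> a < g -> g <= 1 -> (m <= n)%N ->
  \sum_(m <= j < n) `|cesaro_num (- g - 1) j.+1| * cesaro_num a j.+1 <=
  2 * g / (g - a) * (cesaro_num (- g) m * cesaro_num a m).
Proof.
move=> a0 ag g1 mn; pose u j := cesaro_num (- g) j * cesaro_num a j.
have c0 j : 0 <= cesaro_num (- g) j by rewrite cesaro_num_ge0 //; lra.
have w0 j : 0 <= cesaro_num a j by rewrite cesaro_num_ge0 //; lra.
have C0 : 0 <= 2 * g / (g - a) by rewrite divr_ge0 //; lra.
suff: \sum_(m <= j < n) `|cesaro_num (- g - 1) j.+1| * cesaro_num a j.+1 <=
      2 * g / (g - a) * (u m - u n).
  move/le_trans; apply; rewrite ler_wpM2l // lerBlDr lerDl mulr_ge0 //.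
have -> : u m - u n = \sum_(m <= j < n) (u j - u j.+1).
  by under eq_bigr do rewrite -opprB; rewrite sumrN telescope_sumr // opprB.
rewrite mulr_sumr ler_sum // => j _.
have := cesaro_num_prod_decr j a0 (ltW ag) g1; rewrite -/(u j) -/(u j.+1) => H.
have {H} := ler_wpM2l C0 H; apply: le_trans.
rewrite cesaro_num_opp1 normrN ger0_norm; last first.
  by rewrite mulr_ge0 // divr_ge0 //; lra.
have -> : 2 * g / (g - a) * ((g - a) / j.+1%:R * u j) =
          g / j.+1%:R * cesaro_num (- g) j * (2 * cesaro_num a j).
  by rewrite /u; field; rewrite nat1r pnatr_eq0 /= subr_eq0 gt_eqF.
apply: ler_wpM2l; last by rewrite cesaro_num_double //; lra.
by apply: mulr_ge0 (c0 j); rewrite divr_ge0 //; lra.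
Qed.

(** Comparing factors, [A_n^a A_n^d <= n + 1] when [2 d = 1 - a], and [A_n^d]
    tends to infinity. *)
Lemma cvg_cesaro_num_div a : 0 <= a -> a < 1 ->
  cesaro_num a n / n%:R @[n --> \oo] --> 0.
Proof.
move=> a0 a1; pose d := (1 - a) / 2; have d0 : 0 < d by rewrite /d; lra.
have prod_le n : cesaro_num a n * cesaro_num d n <= n.+1%:R.
  elim: n => [|n IH]; first by rewrite !cesaro_num0 mul1r.
  rewrite !cesaro_numS mulrACA.
  have n0 : (0 : R) < n.+1%:R by rewrite ltr0n.
  have n1 : (1 : R) <= n.+1%:R by rewrite ler1n.
  rewrite -[n.+2%:R]natr1; set k := n.+1%:R in IH n0 n1 *.
  apply: (@le_trans _ _ (k * ((a + k) / k * ((d + k) / k)))).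
    by rewrite ler_wpM2r // mulr_ge0 // divr_ge0 //; lra.
  have -> : k * ((a + k) / k * ((d + k) / k)) = (a + k) * (d + k) / k.
    by field; rewrite gt_eqF.
  rewrite ler_pdivrMr // /d; nra.
apply: (@squeeze_cvgr _ _ _ _ (fun=> 0) (fun n => 2 * (cesaro_num d n)^-1)).
- near=> n; have n0 : (0 < n)%N by near: n; exact: nbhs_infty_gt.
  have n0' : (0 : R) < n%:R by rewrite ltr0n.
  rewrite divr_ge0 ?cesaro_num_ge0 //=; last lra.
  have dn : 0 < cesaro_num d n by rewrite cesaro_num_gt0 //; lra.
  rewrite ler_pdivrMr // mulrAC ler_pdivlMr //; apply: le_trans (prod_le n) _.
  have n1 : (1 : R) <= n%:R by rewrite ler1n.
  by rewrite -natr1; lra.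
- exact: cvg_cst.
- rewrite -[X in _ --> X](mulr0 2); apply: cvgM; first exact: cvg_cst.
  apply/gtr0_cvgV0; last exact: cesaro_num_cvgy.
  by near=> n; rewrite cesaro_num_gt0 //; lra.
Unshelve. all: by end_near. Qed.

(** How the Hilbert weights come from the coefficients of [(1 - z)^(-d)]: the
    second factor decreases to [0]. *)
Lemma invn_cesaro_num d n : 0 < d ->
  (n.+1%:R^-1 : R) = cesaro_num (d - 1) n.+1 * (d * cesaro_num d n)^-1.
Proof.
move=> d0; have w0 : cesaro_num d n != 0 by rewrite gt_eqF ?cesaro_num_gt0 //; lra.
have n0 : n.+1%:R != 0 :> R by rewrite pnatr_eq0.
apply: (mulfI n0); rewrite mulrA cesaro_num_shift mulfV // mulfV //.
by rewrite mulf_neq0 // gt_eqF.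
Qed.

End CesaroNumbers.

(** * Real-valued norms and operator norms *)

Section RealNorm.
Variables (R : realType) (X : normedModType R[i]).
Implicit Types x y : X.

(** The norm of a normed module over [R[i]] is itself complex-valued; its real
    part allows order and limit arguments to take place in [R]. *)
Definition rnorm (x : X) : R := complex.Re `|x|.

Lemma rnormE x : `|x| = (rnorm x)%:C.
Proof. by rewrite /rnorm RRe_real // normr_real. Qed.

Lemma rnorm_ge0 x : 0 <= rnorm x.
Proof. by rewrite -ler0c -rnormE normr_ge0. Qed.

Lemma rnorm0 : rnorm 0 = 0.
Proof. by rewrite /rnorm normr0. Qed.

Lemma rnorm_eq0 x : rnorm x = 0 -> x = 0.
Proof. by move=> x0; apply/normr0_eq0; rewrite rnormE x0. Qed.

Lemma rnormD x y : rnorm (x + y) <= rnorm x + rnorm y.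
Proof. by rewrite -lecR rmorphD /= -!rnormE ler_normD. Qed.

Lemma rnormN x : rnorm (- x) = rnorm x.
Proof. by rewrite /rnorm normrN. Qed.

Lemma rnorm_dist x y : rnorm (x - y) = rnorm (y - x).
Proof. by rewrite -opprB rnormN. Qed.

Lemma rnormB x y : rnorm (x - y) <= rnorm x + rnorm y.
Proof. by rewrite -[rnorm y]rnormN rnormD. Qed.

Lemma rnormZ (a : R) x : rnorm (a%:C *: x) = `|a| * rnorm x.
Proof.
apply: complexI; rewrite -rnormE normrZ rnormE rmorphM /=; congr (_ * _).
by rewrite normc_def /= expr0n /= addr0 sqrtr_sqr.
Qed.

Lemma rnorm_sum n (u : 'I_n -> X) :
  rnorm (\sum_k u k) <= \sum_k rnorm (u k).
Proof.
elim/big_rec2: _ => [|i y x _ H]; first by rewrite rnorm0.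
by apply: le_trans (rnormD _ _) _; rewrite lerD2l.
Qed.

Lemma cvg_rnorm {I : Type} {F : set_system I} {FF : Filter F} (f : I -> X) l :
  f i @[i --> F] --> l <-> rnorm (f i - l) @[i --> F] --> 0.
Proof.
split=> [/cvgrPdist_lt H|/cvgr0Pnorm_lt H].
  apply/cvgr0Pnorm_lt => e e0; have e0' : 0 < e%:C by rewrite ltcR.
  near=> i; rewrite ger0_norm ?rnorm_ge0 // -ltcR -rnormE distrC.
  by near: i; exact: H e0'.
apply/cvgrPdist_lt => e e0; have eE : e = (complex.Re e)%:C.
  by rewrite RRe_real // gtr0_real.
rewrite eE in e0 *; near=> i; rewrite distrC rnormE ltcR.
rewrite -[rnorm _]ger0_norm ?rnorm_ge0 //.
by near: i; apply: H; rewrite -ltcR.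
Unshelve. all: by end_near. Qed.

Lemma rnorm_lim_le (u : nat -> X) l c (B : R) :
  u n @[n --> \oo] --> l -> (\forall n \near \oo, rnorm (u n - c) <= B) ->
  rnorm (l - c) <= B.
Proof.
move=> /cvg_rnorm/cvgr0Pnorm_lt ul uB; apply/ler_addgt0Pr => e e0.
near \oo => n.
have -> : l - c = (u n - c) - (u n - l) by rewrite opprB [RHS]addrC addrA subrK.
apply: le_trans (rnormB _ _) _; apply: lerD; first by near: n.
rewrite -[rnorm _]ger0_norm ?rnorm_ge0 // ltW //; near: n; exact: ul.
Unshelve. all: by end_near. Qed.

Lemma opnorm_le (f : X -> X) (C : R) : 0 <= C ->
  (forall x, rnorm (f x) <= C * rnorm x) -> (opnorm f <= C%:E)%E.
Proof.
move=> C0 fC; apply: ge_ereal_sup => _ [x /= x1 <-]; rewrite lee_fin.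
apply: le_trans (fC x) _; rewrite ler_piMr //.
by rewrite -lecR -rnormE.
Qed.

Lemma opnorm_ge0 (f : X -> X) : (0 <= opnorm f)%E.
Proof.
apply: (@le_trans _ _ (rnorm (f 0))%:E); first by rewrite lee_fin rnorm_ge0.
by apply: ereal_sup_ubound; exists 0 => //=; rewrite normr0.
Qed.

(** Real homogeneity is enough to rescale [x] to the unit sphere. *)
Lemma le_opnorm (f : X -> X) (C : R) :
  (forall (t : R) x, f (t%:C *: x) = t%:C *: f x) -> (opnorm f <= C%:E)%E ->
  forall x, rnorm (f x) <= C * rnorm x.
Proof.
move=> fZ fC x; have [x0|x0] := eqVneq (rnorm x) 0.
  have f0 : f x = 0 by rewrite (rnorm_eq0 x0) -(scale0r (0 : X)) (fZ 0) !scale0r.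
  by rewrite f0 rnorm0 x0 mulr0.
have x_gt0 : 0 < rnorm x by rewrite lt_neqAle eq_sym x0 rnorm_ge0.
have {}x0 : rnorm x != 0 by [].
have : ((rnorm (f ((rnorm x)^-1%:C *: x)))%:E <= opnorm f)%E.
  apply: ereal_sup_ubound; exists ((rnorm x)^-1%:C *: x) => //=.
  by rewrite rnormE rnormZ ger0_norm ?invr_ge0 ?rnorm_ge0 // mulVf.
move/le_trans => /(_ _ fC); rewrite lee_fin fZ rnormZ.
by rewrite ger0_norm ?invr_ge0 ?rnorm_ge0 // mulrC ler_pdivrMr.
Qed.

End RealNorm.

(** * Completeness and uniform boundedness *)

Section Complete.
Variables (R : realType) (X : completeNormedModType R[i]).

Lemma rnorm_cauchy_cvg (u : nat -> X) (e : nat -> R) :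
  e n @[n --> \oo] --> 0 ->
  (forall n m, (n <= m)%N -> rnorm (u m - u n) <= e n) -> cvgn u.
Proof.
move=> /cvgr0Pnorm_lt e0 ue; apply/cauchy_cvgP/cauchyP => d d0.
have dE : d = (complex.Re d)%:C by rewrite RRe_real // gtr0_real.
rewrite dE in d0 *; have := e0 _ (_ : 0 < complex.Re d).
rewrite -ltcR => /(_ d0) [N _ HN]; exists (u N).
exists N => //= m /= Nm; rewrite -ball_normE /ball_ /= distrC rnormE ltcR.
apply: le_lt_trans (ue _ _ Nm) _; apply: le_lt_trans (ler_norm _) _.
by apply: HN => /=.
Qed.

(** The tails of the series are dominated by those of its series of norms. *)
Lemma abs_summable_cvg (v : nat -> X) (C : R) :
  (forall n, \sum_(k < n) rnorm (v k) <= C) ->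
  cvgn (fun n => \sum_(k < n) v k).
Proof.
move=> vC; pose s n := \sum_(k < n) rnorm (v k).
have s_nd : nondecreasing_seq s.
  apply/nondecreasing_seqP => n.
  by rewrite /s big_ord_recr /= lerDl rnorm_ge0.
have s_cvg : cvgn s.
  by apply: nondecreasing_is_cvgn => //; exists C => _ [n _ <-]; exact: vC.
apply: (@rnorm_cauchy_cvg _ (fun n => limn s - s n)).
  by rewrite -(subrr (limn s)); apply: cvgB => //; exact: cvg_cst.
move=> n m nm; apply: (@le_trans _ _ (s m - s n)); last first.
  by rewrite lerB //; exact: nondecreasing_cvgn_le.
rewrite /s -(subnKC nm); move: (m - n)%N => k; rewrite !big_split_ord /=.
rewrite [X in rnorm X]addrAC subrr add0r [X in _ <= X]addrAC subrr add0r.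
exact: rnorm_sum.
Qed.

(** A gliding hump argument.  If no uniform bound exists, every ball contains a
    smaller one on which some [L i] is at least [n]: among [x + z] and [x - z],
    one has an image at least as large as that of [z], and [z] can be taken
    small with a large image.  The centres of the nested balls converge to a
    point at which the family is unbounded. *)
Theorem uniform_boundedness (I : Type) (L : I -> X -> X) :
  (forall i x y, L i (x + y) = L i x + L i y) ->
  (forall i (t : R) x, L i (t%:C *: x) = t%:C *: L i x) ->
  (forall i, exists C, forall x, rnorm (L i x) <= C * rnorm x) ->
  (forall x, exists C, forall i, rnorm (L i x) <= C) ->
  exists C, forall i x, rnorm (L i x) <= C * rnorm x.
Proof.
move=> LD LZ Lb Lpt; apply: contrapT => nub.
have L0 i : L i 0 = 0.
  by apply: (addrI (L i 0)); rewrite -LD !addr0.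
have LN i x : L i (- x) = - L i x.
  by apply/eqP; rewrite -addr_eq0 -LD addNr L0.
have step (np : nat * (X * R)) : exists q : X * R, 0 < np.2.2 ->
    [/\ 0 < q.2, q.2 <= np.2.2 / 2, rnorm (q.1 - np.2.1) <= np.2.2 / 2 &
      exists i, forall y, rnorm (y - q.1) <= q.2 -> np.1%:R <= rnorm (L i y)].
  case: np => n [x r] /=; have [r0|r0] := leP r 0.
    by exists (0, 0).
  (* The constant is chosen so that [z] rescaled to norm [r / 2] has an image of
     norm greater than [n + 1]. *)
  have [i [z Lz]] : exists i z, n.+1%:R * (2 / r) * rnorm z < rnorm (L i z).
    apply: contrapT => H; apply: nub; exists (n.+1%:R * (2 / r)) => i z.
    by rewrite leNgt; apply/negP => Hz; apply: H; exists i, z.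
  have z0 : 0 < rnorm z.
    rewrite lt_neqAle rnorm_ge0 andbT; apply: contraTneq Lz => /esym z0.
    by rewrite (rnorm_eq0 z0) L0 rnorm0 mulr0 ltxx.
  pose z' := (r / 2 / rnorm z)%:C *: z.
  have rz : 0 < r / 2 / rnorm z by rewrite !divr_gt0.
  have nz' : rnorm z' = r / 2.
    by rewrite /z' rnormZ gtr0_norm // divfK // gt_eqF.
  have Lz' : n.+1%:R < rnorm (L i z').
    rewrite /z' LZ rnormZ gtr0_norm //.
    have -> : r / 2 / rnorm z * rnorm (L i z) = rnorm (L i z) / (2 / r * rnorm z).
      by field; rewrite !gt_eqF.
    have d0 : 0 < 2 / r * rnorm z by rewrite mulr_gt0 // divr_gt0.
    by rewrite ltr_pdivlMr // mulrA.
  have [x' [xx' Lx']] : exists x', rnorm (x' - x) <= r / 2 /\ n.+1%:R < rnorm (L i x').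
    have [H|H] := ltP n.+1%:R (rnorm (L i (x + z'))).
      by exists (x + z'); rewrite addrAC subrr add0r nz'.
    exists (x - z'); rewrite addrAC subrr add0r rnormN nz'; split => //.
    have : rnorm (L i z' + L i z') <= rnorm (L i (x + z')) + rnorm (L i (x - z')).
      apply: le_trans (rnormB _ _); rewrite !LD LN opprD opprK.
      by rewrite addrACA subrr add0r.
    have -> : L i z' + L i z' = (2 : R)%:C *: L i z'.
      by rewrite rmorph_nat scaler_nat mulr2n.
    by rewrite rnormZ ger0_norm //; lra.
  (* On the new ball [L i] varies by at most [1]. *)
  have [C LC] := Lb i; pose r' := Num.min (r / 2) (1 + `|C|)^-1.
  have C0 : 0 < 1 + `|C| by rewrite ltr_pwDl.
  have r'0 : 0 < r' by rewrite lt_min divr_gt0 //= invr_gt0.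
  exists (x', r') => _; split => //=; first by rewrite ge_min lexx.
  exists i => y yx; have : rnorm (L i (y - x')) <= 1.
    apply: le_trans (LC _) _; apply: (@le_trans _ _ ((1 + `|C|) * (1 + `|C|)^-1)).
      apply: (@le_trans _ _ ((1 + `|C|) * rnorm (y - x'))).
        by rewrite ler_wpM2r ?rnorm_ge0 //; have := ler_norm C; lra.
      by rewrite ler_pM2l //; apply: le_trans yx _; rewrite ge_min lexx orbT.
    by rewrite mulfV // gt_eqF.
  have : rnorm (L i x') <= rnorm (L i y) + rnorm (L i (y - x')).
    by apply: le_trans (rnormB _ _); rewrite LD LN opprD opprK addrA subrr add0r.
  by rewrite -natr1 in Lx'; lra.
have [f Hf] := choice step.
pose p := fix p n := if n is n'.+1 then f (n', p n') else (0 : X, 1 : R).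
have p0 n : 0 < (p n).2.
  by elim: n => [|n IH] //=; have [] := Hf (n, p n) IH.
have pS n := Hf (n, p n) (p0 n).
(* The radius of each ball is kept on the left so that the induction closes. *)
have nested n m : (n <= m)%N -> rnorm ((p m).1 - (p n).1) + (p m).2 <= (p n).2.
  elim: m => [|m IH]; first by rewrite leqn0 => /eqP ->; rewrite subrr rnorm0 add0r.
  rewrite leq_eqVlt => /predU1P[->|]; first by rewrite subrr rnorm0 add0r.
  rewrite ltnS => /IH {}IH; have [_ /= r1 d1 _] := pS m.
  have := rnormD ((p m.+1).1 - (p m).1) ((p m).1 - (p n).1).
  by rewrite addrA subrK /=; lra.
have r_small n : (p n).2 <= n.+1%:R^-1.
  elim: n => [|n IH]; first by rewrite invr1.
  have [_ /= r1 _ _] := pS n; apply: le_trans r1 _.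
  apply: (@le_trans _ _ (n.+1%:R^-1 / 2)); first by rewrite ler_wpM2r.
  rewrite -invfM lef_pV2 ?posrE ?mulr_gt0 ?ltr0n // -natrM ler_nat; lia.
have p_cvg : cvgn (fun n => (p n).1).
  apply: (@rnorm_cauchy_cvg _ (fun n => n.+1%:R^-1)); first exact: cvg_harmonic.
  move=> n m nm; apply: le_trans (r_small n); apply: le_trans (nested _ _ nm).
  by rewrite lerDl ltW.
set x := limn (fun n => (p n).1) in p_cvg.
have [M xM] := Lpt x; have [_ _ _ [i /(_ x) /= H]] := pS (Num.truncn M).+1.
have := xM i; apply/negP; rewrite -ltNge.
apply: lt_le_trans (H _); first exact: truncnS_gt.
apply: (rnorm_lim_le p_cvg); exists (Num.truncn M).+2 => //= m /= nm.
by apply: le_trans (nested _ _ nm); rewrite lerDl ltW.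
Qed.

End Complete.

(** * Convolutions and Dirichlet's test *)

Lemma triangle_exchange (V : nmodType) (F : nat -> nat -> V) N :
  \sum_(i < N) \sum_(j < N - i) F i j = \sum_(n < N) \sum_(k < n.+1) F k (n - k)%N.
Proof.
elim: N => [|N IH]; first by rewrite !big_ord0.
rewrite [RHS]big_ord_recr /= -IH [X in _ + X]big_ord_recr [LHS]big_ord_recr /=.
rewrite subnn subSnn big_ord1 addrA; congr (_ + _); rewrite -big_split /=.
by apply: eq_bigr => i _; rewrite subSn ?(ltnW (ltn_ord i)) // big_ord_recr.
Qed.

(** Mertens's estimate: the terms with [n - i] large are small because [e] is,
    and the remaining ones lie in a tail of the convergent series of [b]. *)
Lemma convol_cvg0 (R : realType) (b e : nat -> R) (C : R) :
  (forall i, 0 <= b i) -> (forall n, \sum_(i < n) b i <= C) ->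
  (forall i, 0 <= e i) -> e n @[n --> \oo] --> 0 ->
  \sum_(i < n) b i * e (n - i)%N @[n --> \oo] --> 0.
Proof.
move=> b0 bC e0 e_cvg; pose s n := \sum_(i < n) b i.
have s_nd : nondecreasing_seq s.
  by apply/nondecreasing_seqP => n; rewrite /s big_ord_recr /= lerDl.
have s_cvg : cvgn s.
  by apply: nondecreasing_is_cvgn => //; exists C => _ [n _ <-]; exact: bC.
have C0 : 0 <= C by apply: le_trans (bC 0%N); rewrite big_ord0.
have [E eE] : exists E, forall n, e n <= E.
  have [E [_ HE]] := cvg_seq_bounded (cvgP _ e_cvg).
  exists (E + 1) => n; apply: le_trans (ler_norm _) _.
  by apply: (HE (E + 1)) => //; rewrite ltrDl.
have E0 : 0 <= E := le_trans (e0 0%N) (eE 0%N).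
apply/cvgr0Pnorm_lt => d d0; pose d1 := d / 2 / (C + 1).
have d1_gt0 : 0 < d1 by rewrite !divr_gt0 //; lra.
have [M _ HM] := (cvgr0Pnorm_lt e).1 e_cvg d1 d1_gt0.
have sM : s (n + M)%N - s n @[n --> \oo] --> 0.
  rewrite -(subrr (limn s)); apply: cvgB => //.
  by rewrite cvg_shiftn.
have d2_gt0 : 0 < d / 2 / (E + 1) by rewrite !divr_gt0 //; lra.
have [P _ HP] := (cvgr0Pnorm_lt _).1 sM _ d2_gt0.
exists (P + M)%N => // n /= PMn.
have [p -> Pp] : exists2 p, n = (p + M)%N & (P <= p)%N.
  by exists (n - M)%N; lia.
rewrite ger0_norm; last by rewrite sumr_ge0 // => i _; rewrite mulr_ge0.
rewrite big_split_ord /=.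
have le1 : \sum_(i < p) b i * e (p + M - i)%N <= C * d1.
  apply: (@le_trans _ _ (\sum_(i < p) b i * d1)).
    apply: ler_sum => i _; rewrite ler_wpM2l // ltW //.
    apply: le_lt_trans (ler_norm _) _; apply: HM => /=.
    by have := ltn_ord i; lia.
  by rewrite -mulr_suml ler_wpM2r // ltW.
have le2 : \sum_(i < M) b (p + i)%N * e (p + M - (p + i))%N <= (s (p + M)%N - s p) * E.
  rewrite /s big_split_ord /= addrAC subrr add0r mulr_suml.
  by apply: ler_sum => i _; rewrite ler_wpM2l.
have := HP p Pp; rewrite ger0_norm ?subr_ge0 ?s_nd ?leq_addr // => sd.
have le3 : (s (p + M)%N - s p) * E <= d / 2.
  apply: (@le_trans _ _ (d / 2 / (E + 1) * E)); first by rewrite ler_wpM2r // ltW.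
  by rewrite mulrAC ler_pdivrMr ?ler_wpM2l //; lra.
have lt1 : C * d1 < d / 2.
  by rewrite /d1 mulrA ltr_pdivrMr; [nra | lra].
lra.
Qed.

Section Dirichlet.
Variables (R : realType) (X : completeNormedModType R[i]).

(** Summation by parts leaves an absolutely convergent series, since the
    decrements of [r] are summable, and a boundary term tending to [0]. *)
Lemma dirichlet_test (v : nat -> X) (r : nat -> R) (C : R) :
  (forall n, rnorm (\sum_(k < n) v k) <= C) ->
  (forall n, r n.+1 <= r n) -> r n @[n --> \oo] --> 0 ->
  cvgn (fun n => \sum_(k < n) (r k)%:C *: v k).
Proof.
move=> vC r_ni r_cvg; pose V n := \sum_(k < n) v k.
have r0 n : 0 <= r n.
  have r_dec : nonincreasing_seq r by apply/nonincreasing_seqP.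
  by rewrite -(cvg_lim _ r_cvg) //; apply: nonincreasing_cvgn_ge r_dec _ n; exact: cvgP r_cvg.
have abel n : \sum_(k < n) (r k)%:C *: v k =
    \sum_(k < n) (r k - r k.+1)%:C *: V k.+1 + (r n)%:C *: V n.
  elim: n => [|n IH]; first by rewrite !big_ord0 /V big_ord0 scaler0 addr0.
  rewrite [LHS]big_ord_recr /= IH [X in _ = X + _]big_ord_recr /= -!addrA.
  congr (_ + _); rewrite rmorphB /= scalerBl subrK [V n.+1]big_ord_recr /=.
  by rewrite scalerDr.
have rV0 : (r n)%:C *: V n @[n --> \oo] --> 0.
  apply/cvg_rnorm; apply: (@squeeze_cvgr _ _ _ _ (fun=> 0) (fun n => r n * C)).
  - near=> n; rewrite subr0 rnorm_ge0 rnormZ ger0_norm //=.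
    by rewrite ler_wpM2l //; exact: vC.
  - exact: cvg_cst.
  - by rewrite -(mul0r C); apply: cvgM => //; exact: cvg_cst.
rewrite (_ : (fun n => _) = (fun n => \sum_(k < n) (r k - r k.+1)%:C *: V k.+1)
    \+ (fun n => (r n)%:C *: V n)); last by apply/funext => n; rewrite abel.
apply: is_cvgD; last exact: cvgP rV0.
apply: (@abs_summable_cvg _ _ (fun k => (r k - r k.+1)%:C *: V k.+1) (r 0%N * C)) => n.
have C0 : 0 <= C by apply: le_trans (vC 0%N); rewrite rnorm_ge0.
apply: (@le_trans _ _ (\sum_(k < n) (r k - r k.+1) * C)).
  by apply: ler_sum => k _; rewrite rnormZ ger0_norm ?subr_ge0 // ler_wpM2l ?subr_ge0 //; exact: vC.
rewrite -mulr_suml ler_wpM2r // -(big_mkord xpredT (fun k => r k - r k.+1)).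
under eq_bigr do rewrite -opprB.
by rewrite sumrN telescope_sumr // opprB lerBlDr lerDl.
Unshelve. all: by end_near. Qed.

End Dirichlet.

(** * Power sums of an operator and growth of its powers *)

Section Iterates.
Variables (R : realType) (X : normedModType R[i]) (T : {linear X -> X}).
Implicit Types x y : X.

Lemma iter_linD n x y : iter n T (x + y) = iter n T x + iter n T y.
Proof. by elim: n => [|n IH] //=; rewrite IH linearD. Qed.

Lemma iter_linZ n (c : R[i]) x : iter n T (c *: x) = c *: iter n T x.
Proof. by elim: n => [|n IH] //=; rewrite IH linearZ. Qed.

Lemma iter_lin0 n : iter n T 0 = 0.
Proof. by rewrite -[in LHS](scale0r (0 : X)) iter_linZ scale0r. Qed.

Lemma iter_linB n x y : iter n T (x - y) = iter n T x - iter n T y.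
Proof. by rewrite iter_linD -scaleN1r iter_linZ scaleN1r. Qed.

Lemma iter_lin_sum n N (u : 'I_N -> X) :
  iter n T (\sum_k u k) = \sum_k iter n T (u k).
Proof. exact: (big_morph _ (iter_linD n) (iter_lin0 n)). Qed.

Definition power_sum (c : nat -> R) (x : X) (N : nat) : X :=
  \sum_(k < N) (c k)%:C *: iter k T x.

Lemma power_sumB c x y N :
  power_sum c (x - y) N = power_sum c x N - power_sum c y N.
Proof.
rewrite /power_sum -sumrB; apply: eq_bigr => k _.
by rewrite iter_linB scalerBr.
Qed.

Lemma power_sum_lin c x N : power_sum c (T x) N = T (power_sum c x N).
Proof.
rewrite linear_sum; apply: eq_bigr => k _.
by rewrite linearZ -iterSr.
Qed.

(** The Cauchy product of two series in [T], truncated at total degree [N]. *)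
Lemma power_sum_convol (b c : nat -> R) x N :
  \sum_(i < N) (b i)%:C *: iter i T (power_sum c x (N - i)) =
  power_sum (fun n => \sum_(k < n.+1) b k * c (n - k)%N) x N.
Proof.
pose F i j := (b i * c j)%:C *: iter (i + j) T x.
transitivity (\sum_(i < N) \sum_(j < N - i) F i j).
  apply: eq_bigr => i _; rewrite [power_sum c x _]/power_sum iter_lin_sum scaler_sumr; apply: eq_bigr => j _.
  by rewrite iter_linZ scalerA -rmorphM -iterD.
rewrite triangle_exchange; apply: eq_bigr => n _.
rewrite rmorph_sum scaler_suml; apply: eq_bigr => k _.
by rewrite /F subnKC // -ltnS.
Qed.

(** The generating series of [S_n^a] is [(1 - z)^(-a)] times that of [T^n], so
    [T^n] is recovered by convolving with the coefficients of [(1 - z)^a], whose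
    absolute values sum to at most [2]. *)
Lemma cesaro_growth (a : R) : 0 < a -> a < 1 -> cesaro_bounded T a ->
  exists2 K : R, 0 <= K &
    forall n x, rnorm (iter n T x) <= K * cesaro_num a n * rnorm x.
Proof.
move=> a0 a1 Tb.
have w0 n : 0 < cesaro_num a n by apply: cesaro_num_gt0; lra.
have [K K0 HK] : exists2 K : R, 0 <= K & forall n, (opnorm (cesaro_mean T a n) <= K%:E)%E.
  move: Tb; rewrite /cesaro_bounded; set s := ereal_sup _ => s_lt.
  have sn n : (opnorm (cesaro_mean T a n) <= s)%E by apply: ereal_sup_ubound; exists n.
  have s0 : (0 <= s)%E := le_trans (opnorm_ge0 _) (sn 0%N).
  exists (fine s); first exact: fine_ge0.
  by move=> n; rewrite fineK // ge0_fin_numE.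
have sum_le n x : rnorm (cesaro_sum T a n x) <= K * cesaro_num a n * rnorm x.
  have meanZ (t : R) y : cesaro_mean T a n (t%:C *: y) = t%:C *: cesaro_mean T a n y.
    rewrite /cesaro_mean /cesaro_sum !scaler_sumr; apply: eq_bigr => k _.
    by rewrite iter_linZ !scalerA; congr (_ *: _); ring.
  have := le_opnorm meanZ (HK n) x; rewrite rnormZ ger0_norm; last by rewrite invr_ge0 ltW.
  by rewrite [_^-1 * _]mulrC ler_pdivrMr // mulrAC.
exists (2 * K) => [|n x]; first by rewrite mulr_ge0.
pose b i : R := cesaro_num (- a - 1) i.
have -> : iter n T x = \sum_(i < n.+1) (b i)%:C *: cesaro_sum T a (n - i) x.
  pose F i j : X := (b i * cesaro_num (a - 1) j)%:C *: iter (n - (i + j)) T x.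
  transitivity (\sum_(i < n.+1) \sum_(j < n.+1 - i) F i j); last first.
    apply: eq_bigr => i _; have ni : (i <= n)%N by rewrite -ltnS.
    rewrite /cesaro_sum big_mkord scaler_sumr -subSn // (reindex_inj rev_ord_inj) /=.
    apply: eq_bigr => j _; have ji : (j < n.+1 - i)%N := ltn_ord j.
    rewrite scalerA -rmorphM /F.
    by congr ((b i * cesaro_num _ _)%:C *: iter _ _ _); lia.
  have FE (m : 'I_n.+1) : \sum_(k < m.+1) F k (m - k)%N =
      (cesaro_num (-1) m : R)%:C *: iter (n - m) T x.
    rewrite (_ : -1 = (- a - 1) + (a - 1) + 1); last by ring.
    rewrite -cesaro_num_convol rmorph_sum scaler_suml; apply: eq_bigr => k _.
    by rewrite /F subnKC // -ltnS.
  rewrite triangle_exchange (eq_bigr _ (fun m _ => FE m)) big_ord_recl /=.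
  rewrite cesaro_numN1 scale1r subn0 big1 ?addr0 // => k _.
  by rewrite cesaro_numN1 scale0r.
apply: le_trans (rnorm_sum _) _.
have Kx0 : 0 <= K * cesaro_num a n * rnorm x.
  by rewrite mulr_ge0 ?rnorm_ge0 // mulr_ge0 // ltW.
apply: (@le_trans _ _ (\sum_(i < n.+1) `|b i| * (K * cesaro_num a n * rnorm x))).
  apply: ler_sum => i _; rewrite rnormZ ler_wpM2l //; apply: le_trans (sum_le _ _) _.
  rewrite ler_wpM2r ?rnorm_ge0 // ler_wpM2l //.
  by apply: cesaro_num_nd (ltW a0) _ _ _; exact: leq_subr.
rewrite -mulr_suml [X in _ <= X](_ : _ = 2 * (K * cesaro_num a n * rnorm x)); last by ring.
rewrite ler_wpM2r //.
rewrite big_ord_recl /b cesaro_num0 normr1.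
rewrite -(big_mkord xpredT (fun i => `|cesaro_num (- a - 1) i.+1|)).
rewrite sum_norm_cesaro_num_opp1 ?(ltW a0) ?(ltW a1) // cesaro_num0.
have : 0 <= cesaro_num (- a) n by apply: cesaro_num_ge0; lra.
lra.
Qed.

End Iterates.

(** * Fractional powers of [I - T] *)

Section FractionalPowers.
Variables (R : realType) (X : completeNormedModType R[i]) (T : {linear X -> X}).
Variables (a K : R).
Hypotheses (a_gt0 : 0 < a) (a_lt1 : a < 1) (K_ge0 : 0 <= K).
Hypothesis T_growth :
  forall n x, rnorm (iter n T x) <= K * cesaro_num a n * rnorm x.

Let w_gt0 n : 0 < cesaro_num a n.
Proof. by apply: cesaro_num_gt0; apply: lt_trans a_gt0; rewrite ltrN10. Qed.

Let w_ge0 n : 0 <= cesaro_num a n := ltW (w_gt0 n).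

Lemma cvg_iter {I : Type} {F : set_system I} {FF : Filter F} m (u : I -> X) l :
  u i @[i --> F] --> l -> iter m T (u i) @[i --> F] --> iter m T l.
Proof.
move=> /cvg_rnorm ul; apply/cvg_rnorm.
apply: (@squeeze_cvgr _ _ _ _ (fun=> 0)
  (fun i => K * cesaro_num a m * rnorm (u i - l))).
- by near=> i; rewrite rnorm_ge0 -iter_linB T_growth.
- exact: cvg_cst.
- by rewrite -(mulr0 (K * cesaro_num a m)); apply: cvgM => //; exact: cvg_cst.
Unshelve. all: by end_near. Qed.

(** Mertens's theorem for series in [T]: the truncated Cauchy product differs
    from the partial sum of [b] at [y] by the sum of [b i T^i] applied to
    remainders of the series of [c], and [||T^i|| = O(A_i^a)]. *)
Lemma power_sum_mertens (b c : nat -> R) (C : R) (x y z : X) :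
  (forall n, \sum_(i < n) `|b i| * cesaro_num a i <= C) ->
  power_sum T c x n @[n --> \oo] --> y ->
  power_sum T b y n @[n --> \oo] --> z ->
  power_sum T (fun n => \sum_(k < n.+1) b k * c (n - k)%N) x n
    @[n --> \oo] --> z.
Proof.
move=> bC cy bz.
pose e n := K * rnorm (power_sum T c x n - y).
have e_cvg : e n @[n --> \oo] --> 0.
  by rewrite -(mulr0 K); apply: cvgM; [exact: cvg_cst | exact/cvg_rnorm].
have e_ge0 n : 0 <= e n by rewrite mulr_ge0 // rnorm_ge0.
have bw0 i : 0 <= `|b i| * cesaro_num a i by rewrite mulr_ge0.
have conv0 := convol_cvg0 bw0 bC e_ge0 e_cvg.
have diff0 : (power_sum T (fun n => \sum_(k < n.+1) b k * c (n - k)%N) x n -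
    power_sum T b y n) @[n --> \oo] --> (0 : X).
  apply/cvg_rnorm; apply: squeeze_cvgr conv0; last exact: cvg_cst.
  near=> n; rewrite subr0 rnorm_ge0 /= -power_sum_convol [power_sum T b y n]/power_sum -sumrB.
  apply: le_trans (rnorm_sum _) _; apply: ler_sum => i _.
  rewrite -scalerBr -iter_linB rnormZ -mulrA ler_wpM2l //.
  by apply: le_trans (T_growth _ _) _; rewrite [K * _]mulrC -mulrA.
rewrite -(add0r z).
under eq_fun => n do rewrite -[power_sum T _ x n](subrK (power_sum T b y n)).
exact: cvgD.
Unshelve. all: by end_near. Qed.

(** The coefficients of the power series of [(1 - z)^g]. *)
Definition frac_coef (g : R) (k : nat) : R := cesaro_num (- g - 1) k.

Lemma frac_coef_convol s t n :
  \sum_(k < n.+1) frac_coef s k * frac_coef t (n - k) = frac_coef (s + t) n.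
Proof. by rewrite cesaro_num_convol /frac_coef; congr cesaro_num; ring. Qed.

Lemma frac_coef_summable g : a < g -> g <= 1 ->
  exists C, forall n, \sum_(i < n) `|frac_coef g i| * cesaro_num a i <= C.
Proof.
move=> ag g1; have a0 := a_gt0; have C0 : 0 <= 2 * g / (g - a) by rewrite divr_ge0 //; lra.
exists (1 + 2 * g / (g - a)) => -[|n]; first by rewrite big_ord0; lra.
rewrite big_ord_recl /frac_coef !cesaro_num0 normr1 mulr1 lerD2l.
rewrite -(big_mkord xpredT
  (fun i => `|cesaro_num (- g - 1) i.+1| * cesaro_num a i.+1)).
apply: le_trans (sum_norm_cesaro_num_weight (ltW a_gt0) ag g1 (leq0n n)) _.
by rewrite !cesaro_num0 !mulr1.
Qed.

(** The fractional power [(I - T)^g]. *)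
Definition frac_pow (g : R) (x : X) : X := limn (power_sum T (frac_coef g) x).

Lemma sum_rnorm_le (b : nat -> R) (C : R) x n :
  \sum_(i < n) `|b i| * cesaro_num a i <= C ->
  \sum_(i < n) rnorm ((b i)%:C *: iter i T x) <= C * (K * rnorm x).
Proof.
move=> bC; have Kx0 : 0 <= K * rnorm x by rewrite mulr_ge0 ?rnorm_ge0.
apply: le_trans (ler_wpM2r Kx0 bC); rewrite mulr_suml; apply: ler_sum => i _.
rewrite rnormZ -mulrA ler_wpM2l //.
by apply: le_trans (T_growth _ _) _; rewrite [K * _]mulrC -mulrA.
Qed.

Lemma cvg_frac_pow g x : a < g -> g <= 1 ->
  power_sum T (frac_coef g) x n @[n --> \oo] --> frac_pow g x.
Proof.
move=> ag g1; have [C HC] := frac_coef_summable ag g1.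
apply: (@abs_summable_cvg _ _ (fun k => (frac_coef g k)%:C *: iter k T x)
  (C * (K * rnorm x))) => n.
exact: sum_rnorm_le.
Qed.

(** Bounding [T^k] and the remainder separately would produce the product of
    two weights, which is too large when [a >= 1/2].  Applying [T^k] inside
    the series and using subadditivity of the weights gives their sum. *)
Lemma frac_pow_tail g m k x : a < g -> g <= 1 ->
  rnorm (iter k T (frac_pow g x - power_sum T (frac_coef g) x m.+1)) <=
  (2 * g / (g - a) * cesaro_num a m + cesaro_num a k) * cesaro_num (- g) m
    * (K * rnorm x).
Proof.
move=> ag g1; have a0 := a_gt0; have Kx0 : 0 <= K * rnorm x by rewrite mulr_ge0 ?rnorm_ge0.
rewrite iter_linB.
have H : iter k T (power_sum T (frac_coef g) x n) @[n --> \oo] -->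
    iter k T (frac_pow g x).
  by apply: cvg_iter; exact: cvg_frac_pow.
apply: (rnorm_lim_le H).
exists m.+1 => // -[|n] //= mn; rewrite -iter_linB.
have {}mn : (m <= n)%N by [].
have -> : power_sum T (frac_coef g) x n.+1 - power_sum T (frac_coef g) x m.+1 =
    \sum_(j < n - m) (frac_coef g (m + j).+1)%:C *: iter (m + j).+1 T x.
  rewrite /power_sum -[in LHS](subnKC mn) -addSn big_split_ord /=.
  rewrite addrAC subrr add0r; apply: eq_bigr => j _.
  by rewrite addSn.
rewrite iter_lin_sum; apply: le_trans (rnorm_sum _) _.
apply: (@le_trans _ _ (\sum_(j < n - m)
   (`|frac_coef g (m + j).+1| * cesaro_num a (m + j).+1 +
    cesaro_num a k * `|frac_coef g (m + j).+1|) * (K * rnorm x))).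
  apply: ler_sum => j _; rewrite iter_linZ -iterD rnormZ.
  rewrite [cesaro_num a k * _]mulrC -mulrDr -mulrA ler_wpM2l //.
  apply: le_trans (T_growth _ _) _; rewrite [K * _]mulrC -mulrA ler_wpM2r //.
  by rewrite addrC; apply: cesaro_num_subadd; exact: ltW.
rewrite -mulr_suml ler_wpM2r // big_split /= -mulr_sumr mulrDl lerD //.
  have := sum_norm_cesaro_num_weight (ltW a_gt0) ag g1 mn.
  rewrite -{1}[m]add0n big_addn big_mkord.
  under eq_bigr do rewrite addnC.
  by move/le_trans; apply; rewrite le_eqVlt; apply/orP; left; apply/eqP; ring.
rewrite ler_wpM2l //.
have := @sum_norm_cesaro_num_opp1 _ g _ _ _ g1 mn.
rewrite -{1}[m]add0n big_addn big_mkord.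
under eq_bigr do rewrite addnC.
move=> ->; last by lra.
have : 0 <= cesaro_num (- g) n by apply: cesaro_num_ge0; lra.
lra.
Qed.

(** The sum of [A_k^(d-1) T^k] over [k < n] applied to [(I - T)^g x] is the
    truncated Cauchy product, that is a partial sum of [(I - T)^(g-d) x], plus
    remainders.  By the previous bound the latter are controlled by the
    convolution [A_n^(d-g)] of [A_k^(d-1)] and [A_k^(-g)], times the weight
    [A_n^a], and this product is at most [1]. *)
Lemma frac_pow_partial_sums g d x : a + d < g -> 0 < d -> g <= 1 ->
  exists C, forall n, rnorm (power_sum T (cesaro_num (d - 1)) (frac_pow g x) n) <= C.
Proof.
move=> adg d0 g1; have a0 := a_gt0; have ag : a < g by lra.
pose e := cesaro_num (d - 1 : R); set y := frac_pow g x.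
have [C HC] : exists C, forall n,
    rnorm (power_sum T (frac_coef (g - d)) x n) <= C.
  have [||C HC] := @frac_coef_summable (g - d); [lra | lra |].
  exists (C * (K * rnorm x)) => n; apply: le_trans (rnorm_sum _) _.
  exact: sum_rnorm_le.
have C1 : 0 <= 2 * g / (g - a) + 1 by rewrite addr_ge0 // divr_ge0 //; lra.
have Kx0 : 0 <= K * rnorm x by rewrite mulr_ge0 ?rnorm_ge0.
exists ((2 * g / (g - a) + 1) * (K * rnorm x) + C) => -[|n].
  rewrite /power_sum big_ord0 rnorm0; apply: addr_ge0 (mulr_ge0 C1 Kx0) _.
  exact: le_trans (rnorm_ge0 _) (HC 0%N).
pose P m := power_sum T (frac_coef g) x m.
have -> : power_sum T e y n.+1 =
    \sum_(k < n.+1) (e k)%:C *: iter k T (y - P (n - k).+1) +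
    power_sum T (frac_coef (g - d)) x n.+1.
  have -> : power_sum T (frac_coef (g - d)) x n.+1 =
      \sum_(k < n.+1) (e k)%:C *: iter k T (P (n.+1 - k)%N).
    rewrite power_sum_convol; apply: eq_bigr => k _; congr (_%:C *: _).
    by rewrite cesaro_num_convol /frac_coef; congr cesaro_num; ring.
  rewrite -big_split /=; apply: eq_bigr => k _.
  by rewrite -scalerDr -iter_linD subSn ?subrK // -ltnS.
apply: le_trans (rnormD _ _) _; apply: lerD (HC _).
apply: le_trans (rnorm_sum _) _.
have e0 k : 0 <= e k by apply: cesaro_num_ge0; lra.
have c0 k : 0 <= cesaro_num (- g) k by apply: cesaro_num_ge0; lra.
apply: (@le_trans _ _ (\sum_(k < n.+1) (e k * cesaro_num (- g) (n - k)) *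
   ((2 * g / (g - a) + 1) * cesaro_num a n * (K * rnorm x)))).
  apply: ler_sum => k _; rewrite rnormZ ger0_norm // -mulrA ler_wpM2l //.
  apply: le_trans (frac_pow_tail _ _ _ ag g1) _.
  rewrite [X in _ <= X](_ : _ = (2 * g / (g - a) + 1) * cesaro_num a n *
    cesaro_num (- g) (n - k) * (K * rnorm x)); last by ring.
  apply: (ler_wpM2r Kx0); apply: ler_wpM2r => //.
  rewrite [X in _ <= X](_ : _ = 2 * g / (g - a) * cesaro_num a n +
    cesaro_num a n); last by ring.
  apply: lerD.
    rewrite ler_wpM2l //; first by rewrite divr_ge0 //; lra.
    by apply: cesaro_num_nd (ltW a_gt0) _ _ _; exact: leq_subr.
  by apply: cesaro_num_nd (ltW a_gt0) _ _ _; rewrite -ltnS.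
rewrite -mulr_suml cesaro_num_convol.
have -> : d - 1 - g + 1 = - (g - d) by ring.
have -> : cesaro_num (- (g - d)) n * ((2 * g / (g - a) + 1) * cesaro_num a n *
  (K * rnorm x)) = (cesaro_num (- (g - d)) n * cesaro_num a n) *
  ((2 * g / (g - a) + 1) * (K * rnorm x)) by ring.
by apply: ler_piMl (mulr_ge0 C1 Kx0) _; apply: cesaro_num_prod_le1; lra.
Qed.

(** Dirichlet's test with the factorization of [1 / k] through the coefficients
    of [(1 - z)^(-d)]. *)
Lemma frac_pow_hilbert g x : a < g -> g <= 1 ->
  hilbert_domain T (frac_pow g x).
Proof.
move=> ag g1; have a0 := a_gt0; pose d := (g - a) / 2; set y := frac_pow g x.
have d0 : 0 < d by rewrite /d; lra.
have adg : a + d < g by rewrite /d; lra.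
have [C HC] := frac_pow_partial_sums x adg d0 g1.
pose v k := (cesaro_num (d - 1) k.+1)%:C *: iter k.+1 T y.
pose r k : R := (d * cesaro_num d k)^-1.
have wd k : 0 < cesaro_num d k by apply: cesaro_num_gt0; lra.
have r_ni n : r n.+1 <= r n.
  rewrite lef_pV2 ?posrE ?(mulr_gt0 d0) // ler_pM2l //.
  exact: cesaro_num_nd (ltW d0) _ _ (leqnSn n).
have r_cvg : r n @[n --> \oo] --> 0.
  under eq_fun do rewrite /r invfM.
  rewrite -(mulr0 d^-1); apply: cvgM; first exact: cvg_cst.
  by apply/gtr0_cvgV0; [near=> n | exact: cesaro_num_cvgy].
have vC n : rnorm (\sum_(k < n) v k) <= C + rnorm y.
  have := HC n.+1; rewrite /power_sum big_ord_recl /= cesaro_num0 scale1r -/y => HS.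
  rewrite -[X in rnorm X](addKr y) addrC.
  by apply: le_trans (rnormB _ _) _; rewrite lerD2r.
rewrite /hilbert_domain /= (_ : (fun n : nat => _) =
    (fun n => \sum_(k < n) (r k)%:C *: v k)); first exact: dirichlet_test vC r_ni r_cvg.
apply/funext => n; rewrite big_add1 big_mkord.
apply: eq_bigr => k _; rewrite /v scalerA -rmorphM [r k * _]mulrC.
by rewrite -invn_cesaro_num // fmorphV rmorph_nat.
Unshelve. all: by end_near. Qed.

(** * The decomposition of the space *)

Definition id_minus (x : X) : X := x - T x.

Lemma id_minusB x y : id_minus (x - y) = id_minus x - id_minus y.
Proof. by rewrite /id_minus linearB !opprB addrACA [RHS]addrACA [- y - _]addrC. Qed.

Lemma id_minusD x y : id_minus (x + y) = id_minus x + id_minus y.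
Proof. by rewrite /id_minus linearD opprD addrACA. Qed.

Lemma frac_pow_id_minus g x : a < g -> g <= 1 ->
  frac_pow g (id_minus x) = id_minus (frac_pow g x).
Proof.
move=> ag g1; apply: (@norm_cvg_unique _ _ (power_sum T (frac_coef g) (id_minus x) @ \oo)).
  exact: cvg_frac_pow.
rewrite (_ : power_sum _ _ _ = (fun n => power_sum T (frac_coef g) x n) \-
    (fun n => iter 1 T (power_sum T (frac_coef g) x n))); last first.
  by apply/funext => n /=; rewrite power_sumB power_sum_lin.
by apply: cvgB; [|apply: cvg_iter]; exact: cvg_frac_pow.
Qed.

Lemma cvg_iter_frac_pow g x k : a < g -> g <= 1 ->
  power_sum T (frac_coef (k.+1%:R * g)) x n @[n --> \oo] -->
  iter k.+1 (frac_pow g) x.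
Proof.
move=> ag g1; have [C HC] := frac_coef_summable ag g1.
elim: k => [|k IH]; first by rewrite mul1r; exact: cvg_frac_pow.
have := power_sum_mertens HC IH (cvg_frac_pow ag g1).
rewrite (_ : (fun n => \sum_(j < n.+1) _) = frac_coef (k.+2%:R * g)) //.
apply/funext => n; rewrite frac_coef_convol; congr frac_coef.
by rewrite -[k.+2%:R]natr1; ring.
Qed.

(** For [g = p] the binomial series is a polynomial; its value is identified by
    the same induction as for [cvg_iter_frac_pow], so that the two limits can be
    compared. *)
Lemma cvg_iter_id_minus p x :
  power_sum T (frac_coef p%:R) x n @[n --> \oo] --> iter p id_minus x.
Proof.
have cN1 : (- 0 - 1 : R) = -1 by rewrite oppr0 add0r.
elim: p => [|p IH].
  apply: cvg_near_cst; exists 1%N => // -[|n] //= _.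
  rewrite /power_sum big_ord_recl /= /frac_coef cesaro_num0 scale1r big1 ?addr0 //.
  by move=> k _; rewrite cN1 cesaro_numN1 scale0r.
have [C HC] := frac_coef_summable a_lt1 (lexx 1).
have H1 : power_sum T (frac_coef 1) (iter p id_minus x) n @[n --> \oo] -->
    iter p.+1 id_minus x.
  apply: cvg_near_cst; exists 2%N => // -[|[|n]] //= _.
  rewrite /power_sum !big_ord_recl big1 /=; last first.
    by move=> k _; rewrite /frac_coef cesaro_num_opp1 cesaro_numN1 mulr0 oppr0 scale0r.
  rewrite /frac_coef cesaro_num0 cesaro_num_opp1 cesaro_numN1 /= divr1 mulr1.
  by rewrite rmorphN rmorph1 scaleN1r scale1r addr0.
have := power_sum_mertens HC IH H1.
rewrite (_ : (fun n => \sum_(j < n.+1) _) = frac_coef p.+1%:R) //.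
by apply/funext => n; rewrite frac_coef_convol nat1r.
Qed.

Lemma iter_frac_pow p x : a < p%:R / p.+1%:R ->
  iter p.+1 (frac_pow (p%:R / p.+1%:R)) x = iter p id_minus x.
Proof.
move=> ap; have p1 : p%:R / p.+1%:R <= 1 :> R.
  by rewrite ler_pdivrMr ?ltr0n // mul1r ler_nat.
apply: (@norm_cvg_unique _ _ (power_sum T (frac_coef p%:R) x @ \oo)).
  have := @cvg_iter_frac_pow _ x p ap p1.
  by rewrite mulrCA mulfV ?mulr1 // pnatr_eq0.
exact: cvg_iter_id_minus.
Qed.

Lemma id_minus_hilbert x : hilbert_domain T (id_minus x).
Proof.
rewrite (_ : id_minus x = frac_pow 1 x); first exact: frac_pow_hilbert.
apply: (@norm_cvg_unique _ _ (power_sum T (frac_coef 1) x @ \oo)).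
  exact: (@cvg_iter_id_minus 1).
exact: cvg_frac_pow.
Qed.

(** If [y = z - T z] is fixed by [T], then [T^n z = z - n y]; the growth
    [||T^n|| = o(n)] leaves only [y = 0]. *)
Lemma id_minus_ascent z : id_minus (id_minus z) = 0 -> id_minus z = 0.
Proof.
set y := id_minus z => y0; have Ty : T y = y by apply/esym/subr0_eq.
have iterE n : iter n T z = z - n%:R *: y.
  elim: n => [|n IH]; first by rewrite scale0r subr0.
  rewrite /= IH linearB linearZ Ty /= -natr1 scalerDl scale1r opprD addrA.
  by rewrite addrAC; congr (_ - _); rewrite /y /id_minus opprB addrCA subrr addr0.
apply: rnorm_eq0; apply/eqP; rewrite eq_le rnorm_ge0 andbT.
have e0 : cesaro_num a n / n%:R * ((1 + K) * rnorm z) @[n --> \oo] --> 0.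
  rewrite -(mul0r ((1 + K) * rnorm z)); apply: cvgM; last exact: cvg_cst.
  exact: cvg_cesaro_num_div (ltW a_gt0) a_lt1.
apply/ler_addgt0Pr => e e_gt0; rewrite add0r.
have [N _ HN] := (cvgr0Pnorm_lt _).1 e0 _ e_gt0.
apply: le_trans (ltW (HN N.+1 (leqnSn N))); apply: le_trans (ler_norm _).
have N0 : (0 : R) < N.+1%:R by rewrite ltr0n.
rewrite mulrAC ler_pdivlMr // mulrC -[N.+1%:R](ger0_norm (ltW N0)) -rnormZ.
have -> : (N.+1%:R : R)%:C *: y = z - iter N.+1 T z.
  by rewrite iterE opprB addrCA subrr addr0 rmorph_nat.
apply: le_trans (rnormB _ _) _.
have w1 : 1 <= cesaro_num a N.+1.
  by rewrite -(cesaro_num0 a); apply: cesaro_num_nd (ltW a_gt0) _ _ (leq0n _).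
have := T_growth N.+1 z; have := rnorm_ge0 z; have := K_ge0; nra.
Qed.

(** With [A = I - T] and [g = p / (p + 1)], the inclusion of [A^g X] in
    [D(H) = A X] iterates to [A^p x = (A^g)^(p+1) x = A^(p+1) y], and
    [A^p (x - A y) = 0] gives [A (x - A y) = 0]. *)
Lemma hilbert_decomposition :
  hilbert_domain T = range id_minus ->
  forall x, exists y, id_minus (x - id_minus y) = 0.
Proof.
move=> HD x.
(* Any [p] with [p + 1 > 1 / (1 - a)] will do. *)
have [p ap] : exists p : nat, a < p%:R / p.+1%:R.
  pose p := Num.truncn (1 - a)^-1; exists p.
  have p0 : (0 : R) < p.+1%:R by rewrite ltr0n.
  rewrite ltr_pdivlMr // -natr1.
  have : (1 - a)^-1 < p.+1%:R by exact: truncnS_gt.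
  have a1 : 0 < 1 - a by rewrite subr_gt0.
  move=> pa; have : 1 < p.+1%:R * (1 - a) by rewrite -ltr_pdivrMr // div1r.
  rewrite -natr1; lra.
set g := p%:R / p.+1%:R in ap; have g1 : g <= 1.
  by rewrite ler_pdivrMr ?ltr0n // mul1r ler_nat.
have sub k u : exists v, iter k (frac_pow g) u = iter k id_minus v.
  elim: k => [|k [v /= ->]]; first by exists u.
  have comm j t : frac_pow g (iter j id_minus t) = iter j id_minus (frac_pow g t).
    by elim: j => //= j IH; rewrite frac_pow_id_minus // IH.
  rewrite comm; have : hilbert_domain T (frac_pow g v) by exact: frac_pow_hilbert.
  by rewrite HD => -[t _ <-]; exists t; rewrite -iterSr.
have [y xy] := sub p.+1 x; exists y.
(* The case [j = 0] is included: there [z = 0]. *)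
have ker j z : iter j id_minus z = 0 -> id_minus z = 0.
  elim: j => [/= -> | [//|j] IH /id_minus_ascent/IH //].
  by rewrite /id_minus linear0 subr0.
have iterB j u v : iter j id_minus (u - v) = iter j id_minus u - iter j id_minus v.
  by elim: j => //= j ->; rewrite id_minusB.
by apply: (ker p); rewrite iterB -iterSr -xy iter_frac_pow // subrr.
Qed.

(** * Ergodic means *)

Lemma ergodic_meanE n x :
  ergodic_mean T n x = (n%:R^-1 : R)%:C *: \sum_(k < n) iter k.+1 T x.
Proof.
by rewrite /ergodic_mean big_add1 big_mkord fmorphV rmorph_nat.
Qed.

Lemma ergodic_meanZ n (c : R[i]) x :
  ergodic_mean T n (c *: x) = c *: ergodic_mean T n x.
Proof.
rewrite !ergodic_meanE scalerA mulrC -scalerA; congr (_ *: _).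
by rewrite scaler_sumr; apply: eq_bigr => k _; rewrite iter_linZ.
Qed.

Lemma ergodic_meanD n x y :
  ergodic_mean T n (x + y) = ergodic_mean T n x + ergodic_mean T n y.
Proof.
rewrite !ergodic_meanE -scalerDr -big_split; congr (_ *: _).
by apply: eq_bigr => k _; rewrite iter_linD.
Qed.

Lemma ergodic_mean_fix n f : id_minus f = 0 -> ergodic_mean T n.+1 f = f.
Proof.
move=> /subr0_eq/esym Tf; rewrite ergodic_meanE.
rewrite (eq_bigr (fun=> f)) => [|k _]; last by elim: (k : nat) => //= j ->.
rewrite sumr_const card_ord -[X in _ *: X]scaler_nat scalerA fmorphV rmorph_nat.
by rewrite mulVf ?scale1r // pnatr_eq0.
Qed.

Lemma ergodic_mean_id_minus n y :
  ergodic_mean T n (id_minus y) = (n%:R^-1 : R)%:C *: (T y - iter n.+1 T y).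
Proof.
rewrite ergodic_meanE; congr (_ *: _).
rewrite (eq_bigr (fun k : 'I_n => - (iter k.+2 T y - iter k.+1 T y))); last first.
  by move=> k _; rewrite opprB /id_minus iter_linB -iterSr.
rewrite sumrN -(big_mkord xpredT (fun k => iter k.+2 T y - iter k.+1 T y)).
by rewrite (telescope_sumr (fun k => iter k.+1 T y)) // opprB.
Qed.

Lemma ergodic_mean_bounded n :
  exists C, forall x, rnorm (ergodic_mean T n x) <= C * rnorm x.
Proof.
exists (n%:R^-1 * \sum_(k < n) K * cesaro_num a k.+1) => x.
rewrite ergodic_meanE rnormZ ger0_norm ?invr_ge0 // -mulrA ler_wpM2l ?invr_ge0 //.
rewrite mulr_suml; apply: le_trans (rnorm_sum _) _.
by apply: ler_sum => k _; exact: T_growth.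
Qed.

Lemma ergodic_mean_id_minus_le n y :
  rnorm (ergodic_mean T n.+1 (id_minus y)) <=
  3 * K * rnorm y * (cesaro_num a n.+1 / n.+1%:R).
Proof.
rewrite ergodic_mean_id_minus rnormZ ger0_norm ?invr_ge0 //.
rewrite [X in _ <= X]mulrA [X in _ <= X]mulrC ler_wpM2l ?invr_ge0 //.
apply: le_trans (rnormB _ _) _.
have H1 := T_growth 1 y; have H2 := T_growth n.+2 y.
have w1 : cesaro_num a 1 <= cesaro_num a n.+1.
  by apply: cesaro_num_nd (ltW a_gt0) _ _ _.
have w2 := cesaro_num_double n.+1 (ltW a_gt0) (ltW a_lt1).
have Ky : 0 <= K * rnorm y by rewrite mulr_ge0 ?rnorm_ge0.
rewrite /= in H1 H2 *; nra.
Qed.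

Lemma cvg_ergodic_mean_id_minus y :
  ergodic_mean T n.+1 (id_minus y) @[n --> \oo] --> (0 : X).
Proof.
apply/cvg_rnorm; apply: (@squeeze_cvgr _ _ _ _ (fun=> 0)
  (fun n => 3 * K * rnorm y * (cesaro_num a n.+1 / n.+1%:R))).
- by near=> n; rewrite subr0 rnorm_ge0 ergodic_mean_id_minus_le.
- exact: cvg_cst.
- rewrite -(mulr0 (3 * K * rnorm y)); apply: cvgM; first exact: cvg_cst.
  rewrite (cvg_shiftS (fun n => cesaro_num a n / n%:R)).
  exact: cvg_cesaro_num_div (ltW a_gt0) a_lt1.
Unshelve. all: by end_near. Qed.

Let pack_linear (f : X -> X) (lf : linear f) : {linear X -> X} :=
  HB.pack f (GRing.isLinear.Build _ _ _ _ _ lf).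

(** On [x = A y + f] the means [M_n] approach [f] at the rate [e n], with a
    constant depending on [x].  Uniform boundedness is applied to the
    differences [(M_n - M_m) / (e n + e m)], which are continuous before the
    limit [P] is known to be; letting [m] grow bounds [M_n - P]. *)
Lemma decomposition_uniformly_ergodic :
  (forall x, exists y, id_minus (x - id_minus y) = 0) -> uniformly_ergodic T.
Proof.
move=> dec; pose e n := cesaro_num a n.+1 / n.+1%:R.
have e_gt0 n : 0 < e n by rewrite divr_gt0 ?ltr0n.
have e_cvg : e n @[n --> \oo] --> 0.
  rewrite (cvg_shiftS (fun n => cesaro_num a n / n%:R)).
  exact: cvg_cesaro_num_div (ltW a_gt0) a_lt1.
pose M n := ergodic_mean T n.+1.
have MN n x y : M n (x - y) = M n x - M n y.
  by rewrite /M ergodic_meanD -scaleN1r ergodic_meanZ scaleN1r.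
have M_dec x : exists f, exists2 C, 0 <= C & forall n, rnorm (M n x - f) <= C * e n.
  have [y fy] := dec x; exists (x - id_minus y), (3 * K * rnorm y).
    by rewrite !mulr_ge0 ?rnorm_ge0.
  move=> n; rewrite -[X in M n X](subrK (id_minus y)) /M ergodic_meanD.
  by rewrite ergodic_mean_fix // addrAC subrr add0r ergodic_mean_id_minus_le.
pose P x := limn (fun n => M n x).
have P_cvg x : M n x @[n --> \oo] --> P x.
  have [f [C C0 Hf]] := M_dec x; apply: (cvgP f); apply/cvg_rnorm.
  apply: (@squeeze_cvgr _ _ _ _ (fun=> 0) (fun n => C * e n)).
  - by near=> n; rewrite rnorm_ge0 Hf.
  - exact: cvg_cst.
  - by rewrite -(mulr0 C); apply: cvgM => //; exact: cvg_cst.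
have [C HC] : exists C, forall (nm : nat * nat) x,
    rnorm (((e nm.1 + e nm.2)^-1)%:C *: (M nm.1 x - M nm.2 x)) <= C * rnorm x.
  have e2 (nm : nat * nat) : 0 < e nm.1 + e nm.2 by rewrite addr_gt0.
  apply: uniform_boundedness => [[n m] x y|[n m] t x|[n m]|x] /=.
  - by rewrite -scalerDr /M !ergodic_meanD opprD addrACA.
  - by rewrite /M !ergodic_meanZ -scalerBr !scalerA mulrC.
  - have [C1 H1] := ergodic_mean_bounded n.+1.
    have [C2 H2] := ergodic_mean_bounded m.+1.
    exists ((e n + e m)^-1 * (C1 + C2)) => x.
    rewrite rnormZ ger0_norm ?invr_ge0 ?(ltW (e2 (n, m))) //.
    rewrite -mulrA ler_wpM2l ?invr_ge0 ?(ltW (e2 (n, m))) // mulrDl.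
    by apply: le_trans (rnormB _ _) _; exact: lerD (H1 x) (H2 x).
  - have [f [C C0 Hf]] := M_dec x; exists C => -[n m] /=.
    rewrite rnormZ ger0_norm ?invr_ge0 ?(ltW (e2 (n, m))) //.
    rewrite mulrC ler_pdivrMr ?(e2 (n, m)) //.
    rewrite -(subrK f (M n x)) -addrA; apply: le_trans (rnormD _ _) _.
    by rewrite [rnorm (f - _)]rnorm_dist mulrDr lerD.
have C0 x : 0 <= C * rnorm x := le_trans (rnorm_ge0 _) (HC (0%N, 0%N) x).
have MP n x : rnorm (M n x - P x) <= C * e n * rnorm x.
  rewrite rnorm_dist; apply/ler_addgt0Pr => d d0.
  apply: (rnorm_lim_le (P_cvg x)).
  have d1 : 0 < d / (C * rnorm x + 1) by rewrite divr_gt0 // ltr_pwDr.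
  have [N _ HN] := (cvgr0Pnorm_lt _).1 e_cvg _ d1.
  exists N => // m /= Nm; have := HC (m, n) x => /=.
  rewrite rnormZ ger0_norm ?invr_ge0 ?addr_ge0 ?(ltW (e_gt0 _)) //.
  rewrite mulrC ler_pdivrMr ?addr_gt0 // => /le_trans; apply.
  rewrite mulrDr addrC mulrAC lerD2l.
  have := HN m Nm; rewrite gtr0_norm // ltr_pdivlMr ?ltr_pwDr // => H.
  by have := e_gt0 m; have := C0 x; nra.
have P_lin : linear P.
  move=> c x y; apply: (@norm_cvg_unique _ _ (fmap (fun n => M n (c *: x + y)) \oo)).
    exact: P_cvg.
  rewrite (_ : (fun n => _) = (fun n => c *: M n x + M n y)); last first.
    by apply/funext => n; rewrite /M ergodic_meanD ergodic_meanZ.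
  apply: cvgD; last exact: P_cvg.
  by apply: cvgZr; exact: P_cvg.
have [C1 HC1] := ergodic_mean_bounded 1.
have P_bound x : rnorm (P x) <= (C1 + C * e 0%N) * rnorm x.
  rewrite -[P x](subKr (M 0%N x)) mulrDl; apply: le_trans (rnormB _ _) _.
  exact: lerD (HC1 x) (MP 0%N x).
have PB x y : P (x - y) = P x - P y := linearB (pack_linear P_lin) x y.
exists (pack_linear P_lin); split.
  move=> x; apply/cvg_rnorm; apply: (@squeeze_cvgr _ _ _ _ (fun=> 0)
    (fun y => (C1 + C * e 0%N) * rnorm (y - x))).
  - by near=> y; rewrite rnorm_ge0 -PB P_bound.
  - exact: cvg_cst.
  - rewrite -(mulr0 (C1 + C * e 0%N)); apply: cvgM; first exact: cvg_cst.
    by apply/cvg_rnorm; exact: cvg_id.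
suff H : opnorm (fun x => M n x - P x) @[n --> \oo] --> 0%E.
  by rewrite -(cvg_shiftS (fun n => opnorm (fun x => ergodic_mean T n x - _ x))).
apply: (squeeze_cvge (f := fun=> 0%E) (h := fun n => (`|C| * e n)%:E)).
- near=> n; rewrite opnorm_ge0 /=; apply: opnorm_le => [|x].
    by rewrite mulr_ge0 // ltW.
  apply: le_trans (MP n x) _; apply: ler_wpM2r (rnorm_ge0 x) _ _ _.
  exact: ler_wpM2r (ltW (e_gt0 n)) _ _ (ler_norm C).
- exact: cvg_cst.
- apply: cvg_EFin; first by near=> n.
  by rewrite -(mulr0 `|C|); apply: cvgM => //; exact: cvg_cst.
Unshelve. all: by end_near. Qed.

(** * Consequences of uniform ergodicity *)

(** Each [I - T^k] is [I - T] times a partial sum of powers. *)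
Lemma mean_remainder_bounded n : exists q : X -> X, exists C, 0 <= C /\
  forall x, x - ergodic_mean T n.+1 x = id_minus (q x) /\
            rnorm (q x) <= C * rnorm x.
Proof.
pose s j x := \sum_(i < j) iter i T x.
pose q x := (n.+1%:R^-1 : R)%:C *: \sum_(k < n.+1) s k.+1 x.
pose C := n.+1%:R^-1 * \sum_(k < n.+1) \sum_(i < k.+1) K * cesaro_num a i.
have C0 : 0 <= C.
  rewrite mulr_ge0 ?invr_ge0 //; apply: sumr_ge0 => k _; apply: sumr_ge0 => i _.
  by rewrite mulr_ge0.
exists q, C; split=> // x; split.
  have sE j : s j x - T (s j x) = x - iter j T x.
    rewrite /s linear_sum -sumrB.
    elim: j => [|j IH]; first by rewrite big_ord0 subrr.
    by rewrite big_ord_recr IH /= addrA subrK.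
  rewrite /id_minus /q [T (_ *: _)]linearZZ -scalerBr linear_sum -sumrB.
  rewrite (eq_bigr (fun k : 'I_n.+1 => x - iter k.+1 T x)) => [|k _]; last exact: sE.
  rewrite ergodic_meanE sumrB scalerBr; congr (_ - _).
  rewrite sumr_const card_ord -[X in _ *: X]scaler_nat scalerA fmorphV rmorph_nat.
  by rewrite mulVf ?scale1r // pnatr_eq0.
rewrite /q rnormZ ger0_norm ?invr_ge0 // /C -mulrA ler_wpM2l ?invr_ge0 //.
apply: le_trans (rnorm_sum _) _; rewrite mulr_suml; apply: ler_sum => k _.
apply: le_trans (rnorm_sum _) _; rewrite mulr_suml; apply: ler_sum => i _.
exact: T_growth.
Qed.

Lemma harmonic_divergence (f : X) :
  cvgn (fun n => (\sum_(k < n) k.+1%:R^-1 : R)%:C *: f) -> f = 0.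
Proof.
move=> /cvg_rnorm/cvgr0Pnorm_lt H; set l := limn _ in H; apply: contrapT => f0.
have f_gt0 : 0 < rnorm f.
  by rewrite lt_neqAle rnorm_ge0 andbT; apply/eqP => /esym/rnorm_eq0.
have hy : series (@harmonic R) n @[n --> \oo] --> +oo.
  apply: (@nondecreasing_dvgn_lt R (series harmonic)); last exact: dvg_harmonic.
  by apply/nondecreasing_series => i _; rewrite /= invr_ge0.
suff: False by [].
near \oo => n.
have h1 : (1 + rnorm l) / rnorm f <= series harmonic n.
  by near: n; move/cvgryPge: hy; apply.
have h2 : `|rnorm ((\sum_(k < n) k.+1%:R^-1 : R)%:C *: f - l)| < 1.
  by near: n; exact: H.
move: h1 h2; rewrite /series /= big_mkord ger0_norm ?rnorm_ge0 // ler_pdivrMr //.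
set h := \sum_(k < n) _ => h1 h2.
have := rnormD (h%:C *: f - l) l; rewrite subrK rnormZ.
have := ler_wpM2r (rnorm_ge0 f) (ler_norm h); lra.
Unshelve. all: by end_near. Qed.

(** The limit [P] of the means vanishes on the range of [I - T] and has fixed
    values.  On its kernel a mean close to [P] is a contraction, and a Neumann
    series inverts [I - T] there. *)
Lemma uniformly_ergodic_hilbert_domain :
  uniformly_ergodic T -> hilbert_domain T = range id_minus.
Proof.
case=> P [_ HP].
have unif (d : R) : 0 < d -> exists N, forall n x, (N <= n)%N ->
    rnorm (ergodic_mean T n x - P x) <= d * rnorm x.
  move=> d0; have /fine_cvgP[[N1 _ H1] /cvgr0Pnorm_lt/(_ d d0)[N2 _ H2]] := HP.
  exists (N1 + N2)%N => n x Nn.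
  apply: (@le_opnorm _ _ (fun x => ergodic_mean T n x - P x)).
    by move=> t y; rewrite ergodic_meanZ [P (_ *: _)]linearZZ -scalerBr.
  rewrite -(fineK (H1 n _)) /=; last by apply: leq_trans Nn; exact: leq_addr.
  rewrite lee_fin; apply: le_trans (ler_norm _) _; apply: ltW; apply: H2 => /=.
  by apply: leq_trans Nn; exact: leq_addl.
have P_cvg x : ergodic_mean T n.+1 x @[n --> \oo] --> P x.
  apply/cvg_rnorm/cvgr0Pnorm_lt => d d0.
  have d1 : 0 < d / (rnorm x + 1) by rewrite divr_gt0 // ltr_wpDl ?rnorm_ge0.
  have [N HN] := unif _ d1; exists N => // n /= Nn.
  rewrite ger0_norm ?rnorm_ge0 //; apply: le_lt_trans (HN _ x (leqW Nn)) _.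
  by rewrite mulrAC ltr_pdivrMr ?ltr_wpDl ?rnorm_ge0 // ltr_pM2l // ltrDl.
have P_id_minus x : P (id_minus x) = 0.
  apply: (@norm_cvg_unique _ _ (fmap (fun n => ergodic_mean T n.+1 (id_minus x)) \oo)).
    exact: P_cvg.
  exact: cvg_ergodic_mean_id_minus.
have P_fix x : id_minus (P x) = 0.
  rewrite -(P_id_minus x).
  apply: (@norm_cvg_unique _ _ (fmap (fun n => ergodic_mean T n.+1 (id_minus x)) \oo)).
    rewrite (_ : (fun n => _) = (fun n => ergodic_mean T n.+1 x) \-
      (fun n => iter 1 T (ergodic_mean T n.+1 x))).
      by apply: cvgB; [|apply: cvg_iter]; exact: P_cvg.
    apply/funext => n /=; rewrite /id_minus -scaleN1r ergodic_meanD ergodic_meanZ.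
    rewrite scaleN1r !ergodic_meanE [T (_ *: _)]linearZZ; congr (_ - _ *: _).
    by rewrite linear_sum; apply: eq_bigr => k _; rewrite -iterSr.
  exact: P_cvg.
have P_idem x : P (P x) = P x.
  apply: (@norm_cvg_unique _ _ (fmap (fun n => ergodic_mean T n.+1 (P x)) \oo)).
    exact: P_cvg.
  by apply: cvg_near_cst; near=> n; rewrite ergodic_mean_fix.
have half_gt0 : 0 < 2^-1 :> R by rewrite invr_gt0.
have [N HN] := unif _ half_gt0.
have [q [C [C0 qP]]] := mean_remainder_bounded N.
pose Q := ergodic_mean T N.+1.
have PQ x : P (Q x) = P x.
  by apply/esym/subr0_eq; rewrite -linearB (qP x).1 P_id_minus.
have ker_range x : P x = 0 -> exists y, x = id_minus y.
  move=> Px; pose z j := iter j Q x.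
  have Pz j : P (z j) = 0 by elim: j => //= j IH; rewrite PQ.
  have z_le j : rnorm (z j) <= 2^-1 ^+ j * rnorm x.
    elim: j => [|j IH]; first by rewrite expr0 mul1r.
    have := HN N.+1 (z j) (leqnSn N); rewrite Pz subr0 => /le_trans; apply.
    by rewrite exprS -mulrA ler_pM2l.
  pose u n := \sum_(j < n) q (z j).
  have u_cvg : cvgn u.
    apply: (@abs_summable_cvg _ _ (q \o z) (C * (2 * rnorm x))) => n.
    apply: (@le_trans _ _ (C * (\sum_(j < n) 2^-1 ^+ j * rnorm x))).
      rewrite mulr_sumr; apply: ler_sum => j _; apply: le_trans (qP _).2 _.
      by rewrite ler_wpM2l.
    rewrite ler_wpM2l // -mulr_suml ler_wpM2r ?rnorm_ge0 //.
    (* The partial geometric sums equal [2 - 2 / 2^n]. *)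
    suff : \sum_(j < n) 2^-1 ^+ j + 2 * 2^-1 ^+ n <= 2 :> R.
      by have := exprn_ge0 n (ltW half_gt0); lra.
    elim: n => [|n IH]; first by rewrite big_ord0 expr0; lra.
    by rewrite big_ord_recr /= exprS; lra.
  exists (limn u).
  have uE n : id_minus (u n) = x - z n.
    elim: n => [|n IH]; first by rewrite /u big_ord0 /id_minus linear0 !subrr.
    rewrite /u big_ord_recr /= id_minusD IH -(qP (z n)).1 addrA subrK.
    by [].
  apply: (@norm_cvg_unique _ _ (fmap (fun n => x - z n) \oo)).
    suff: (x - z n) @[n --> \oo] --> x - 0 by rewrite subr0.
    apply: cvgB; first exact: cvg_cst.
    apply/cvg_rnorm; apply: (@squeeze_cvgr _ _ _ _ (fun=> 0)
      (fun n => 2^-1 ^+ n * rnorm x)).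
    - by near=> n; rewrite subr0 rnorm_ge0 z_le.
    - exact: cvg_cst.
    - rewrite -(mul0r (rnorm x)); apply: cvgM; last exact: cvg_cst.
      by apply: cvg_expr; rewrite ger0_norm ?(ltW half_gt0) // invf_lt1 // ltr1n.
  rewrite (_ : (fun n => _) = u \- (fun n => iter 1 T (u n))).
    by apply: cvgB => //; apply: cvg_iter.
  by apply/funext => n /=; rewrite -uE.
apply/seteqP; split => [x Hx|_ [y _ <-]]; last exact: id_minus_hilbert.
have [y xy] : exists y, x - P x = id_minus y.
  by apply: ker_range; rewrite linearB P_idem subrr.
suff Px0 : P x = 0 by exists y => //; rewrite -xy Px0 subr0.
apply: harmonic_divergence.
have Hy : hilbert_domain T (id_minus y) by exact: id_minus_hilbert.
rewrite /hilbert_domain /= in Hx Hy.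
rewrite (_ : (fun n => _) =
    (fun n : nat => \sum_(1 <= k < n.+1) k%:R^-1 *: iter k T x) \-
    (fun n : nat => \sum_(1 <= k < n.+1) k%:R^-1 *: iter k T (id_minus y))).
  exact: is_cvgB.
apply/funext => n /=; rewrite -sumrB big_add1 big_mkord rmorph_sum scaler_suml.
apply: eq_bigr => k _; rewrite -scalerBr -iter_linB -xy subKr.
have TP : T (P x) = P x by apply/esym/subr0_eq; exact: P_fix.
have -> : iter k.+1 T (P x) = P x by elim: (k.+1) => //= i ->.
by rewrite fmorphV rmorph_nat.
Unshelve. all: by end_near. Qed.

End FractionalPowers.

(** * The characterization of uniform ergodicity *)

Theorem theorem3p11 (R : realType) (X : completeNormedModType R[i])
  (T : {linear X -> X}) (a : R) :
  0 < a -> a < 1 -> continuous T -> cesaro_bounded T a ->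
  uniformly_ergodic T <-> hilbert_domain T = range (fun x : X => x - T x).
Proof.
move=> a0 a1 _ Tb; have [K K0 TK] := cesaro_growth a0 a1 Tb; split.
  exact: uniformly_ergodic_hilbert_domain a0 a1 K0 TK.
move=> HD; apply: (decomposition_uniformly_ergodic a0 a1 K0 TK).
exact: (hilbert_decomposition a0 a1 K0 TK HD).
Qed.
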